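(* Let $G=(V,E)$ be a finite digraph that contains neither multisquares nor double arrows. Then the canonical Hodge Laplacian $\Delta_1$ of $G$ satisfies $$\lambda_{\max}(\Delta_1)\le \max\Big(2\max_{i\in V}\deg i,\ \max_{\xi\in E}\big(3\deg_{\Delta}\xi+2\deg_{\Box}\xi\big)\Big).$$
   Context: A digraph $G=(V,E)$ consists of a finite vertex set $V$ and a set $E$ of ordered pairs of distinct vertices (arrows), written $i\to j$. An elementary $p$-path ($p\ge 0$) is a sequence $i_0\dots i_p$ of vertices, with associated basis symbol $e_{i_0\dots i_p}$; it is regular if $i_{k-1}\ne i_k$ for all $k=1,\dots,p$, and allowed if $i_{k-1}\to i_k$ for all $k=1,\dots,p$. $\mathcal R_p$ is the real vector space with basis the regular elementary $p$-paths. The boundary operator $\partial:\mathcal R_p\to\mathcal R_{p-1}$ is $\partial e_{i_0\dots i_p}=\sum_{k=0}^p(-1)^k e_{i_0\dots\widehat{i_k}\dots i_p}$ (index $i_k$ omitted), where every non-regular term on the right is replaced by $0$; and $\mathcal R_{-1}=\{0\}$, $\partial e_i=0$. $\mathcal A_p\subset\mathcal R_p$ is the span of the allowed elementary $p$-paths ($\mathcal A_{-1}=\{0\}$), and $\Omega_p=\Omega_p(G)=\{u\in\mathcal A_p:\partial u\in\mathcal A_{p-1}\}$. Then $\partial\Omega_p\subset\Omega_{p-1}$ and $\partial^2=0$. Canonical Hodge Laplacian: equip $\mathcal R_p$ with the inner product for which the regular elementary paths are orthonormal, restrict it to $\Omega_p$, let $\partial^*:\Omega_{p-1}\to\Omega_p$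 be the adjoint of $\partial:\Omega_p\to\Omega_{p-1}$, and put $\Delta_p=\partial\partial^*+\partial^*\partial:\Omega_p\to\Omega_p$. $\lambda_{\max}(A)$ denotes the maximal eigenvalue of a self-adjoint operator $A$. A double arrow is a pair of distinct vertices $i,j$ with $i\to j\to i$. A triangle is formed by three distinct vertices $i,j,k$ with $i\to j\to k$ and $i\to k$ (it contains the arrows $i\to j$, $j\to k$, $i\to k$). A square is formed by four distinct vertices $i,j,j',k$ with $i\to j\to k$, $i\to j'\to k$ and $i\not\to k$ (it contains the four arrows $i\to j$, $j\to k$, $i\to j'$, $j'\to k$; interchanging $j$ and $j'$ gives the same square). A multisquare is a sequence of $m+3$ distinct vertices $a,b_0,b_1,\dots,b_m,c$ with $m\ge 2$ such that $a\to b_k\to c$ for all $k=0,\dots,m$ and $a\not\to c$. For a vertex $i$, $\deg i$ is the total number of arrows having $i$ as one of their ends. For an arrow $\xi\in E$, $\deg_\Delta\xi$ is the number of triangles containing $\xi$ and $\deg_\Box\xi$ is the number of squares containing $\xi$. *)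

(* Defs.v *)
From HB Require Import structures.
From mathcomp Require Import all_boot all_order all_algebra.
From mathcomp Require Import boolp classical_sets reals zify.

Set Implicit Arguments.
Unset Strict Implicit.
Unset Printing Implicit Defensive.

Import Order.TTheory GRing.Theory Num.Theory.
Local Open Scope ring_scope.

(* A digraph is a finite type V with an irreflexive relation E : rel V;
   i -> j is written E i j. *)

Section Combinatorics.
Variables (V : finType) (E : rel V).

Definition double_arrow (i j : V) : bool := [&& i != j, E i j & E j i].

Definition multisquare (m : nat) (a : V) (b : m.+1.-tuple V) (c : V) : bool :=
  [&& (2 <= m)%N, uniq (a :: rcons b c),
      [forall k, E a (tnth b k) && E (tnth b k) c] & ~~ E a c].

Definition no_double_arrows : Prop := forall i j, ~~ double_arrow i j.

Definition no_multisquares : Prop :=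
  forall m a (b : m.+1.-tuple V) c, ~~ multisquare a b c.

Definition arrow (xi : V * V) : bool := E xi.1 xi.2.

Definition deg (i : V) : nat :=
  #|[set xi | arrow xi & (xi.1 == i) || (xi.2 == i)]|.

(* The arrows of a triangle on a given vertex set determine the order i, j, k,
   so triangles are ordered triples. *)
Definition triangle (t : V * V * V) : bool :=
  let: (i, j, k) := t in [&& uniq [:: i; j; k], E i j, E j k & E i k].

Definition triangle_arrows (t : V * V * V) : seq (V * V) :=
  let: (i, j, k) := t in [:: (i, j); (j, k); (i, k)].

Definition deg_triangle (xi : V * V) : nat :=
  #|[set t | triangle t & xi \in triangle_arrows t]|.

(* The square i, j, j', k is encoded as (i, {j, j'}, k), with an unordered
   middle pair, so that interchanging j and j' gives the same square. *)
Definition square (q : V * {set V} * V) : bool :=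
  let: (i, B, k) := q in
  [exists j, exists j',
    [&& B == [set j; j'], uniq [:: i; j; j'; k],
        E i j && E j k, E i j' && E j' k & ~~ E i k]].

Definition square_contains (xi : V * V) (q : V * {set V} * V) : bool :=
  let: (i, B, k) := q in
  ((xi.1 == i) && (xi.2 \in B)) || ((xi.1 \in B) && (xi.2 == k)).

Definition deg_square (xi : V * V) : nat :=
  #|[set q | square q & square_contains xi q]|.

End Combinatorics.

(* Paths and chains are indexed by the number n of vertices: [chain R V n] is
   the space R_p of the literature with p = n - 1.  The empty sequence is
   declared non-regular, so that [chain R V 0] = R_(-1) = 0 and the boundary
   of a vertex is 0. *)
Definition regular (V : eqType) (s : seq V) : bool :=
  (s != [::]) && sorted (fun x y => x != y) s.

Notation rpath V n := {s : n.-tuple V | regular s}.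
Notation chain R V n := {ffun rpath V n -> R^o}.

Section PathSpaces.
Variables (R : realType) (V : finType).
Local Notation chain n := (chain R V n).

(* The basis element of a regular s : n.-tuple V; it is 0 when s is not
   regular, which is the convention for the terms of the boundary. *)
Definition epath n (s : seq V) : chain n :=
  [ffun x : rpath V n => ((val (val x) == s)%:R : R^o)].

Definition omit (k : nat) (s : seq V) : seq V := take k s ++ drop k.+1 s.

Definition bd_fun n (u : chain n.+1) : chain n :=
  \sum_(x : rpath V n.+1)
     u x *: \sum_(k < n.+1) (-1) ^+ k *: epath n (omit k (val (val x))).

Fact bd_is_linear n : linear (@bd_fun n).
Proof.
move=> a u v; rewrite /bd_fun scaler_sumr -big_split /=.
by apply: eq_bigr => x _; rewrite !ffunE scalerDl scalerA.
Qed.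
HB.instance Definition _ n :=
  GRing.isLinear.Build R (chain n.+1) (chain n) _ (@bd_fun n)
    (@bd_is_linear n).

Definition bd n : 'Hom(chain n.+1, chain n) := linfun (@bd_fun n).

Definition dot n (u v : chain n) : R := \sum_x u x * v x.

Fact dotC n (u v : chain n) : dot u v = dot v u.
Proof. by apply: eq_bigr => x _; rewrite mulrC. Qed.

Fact dot_linearr n (u : chain n) : linear (dot u : chain n -> R^o).
Proof.
move=> a v w; rewrite /dot scaler_sumr -big_split /=.
by apply: eq_bigr => x _; rewrite !ffunE mulrDr mulrCA.
Qed.

Fact dot_eq0 n (u : chain n) : dot u u = 0 -> u = 0.
Proof.
move=> u0; apply/ffunP => x; rewrite ffunE; apply/eqP; rewrite -sqrf_eq0 expr2.
by apply/eqP; apply: (psumr_eq0P _ u0) => // i _; rewrite -expr2 sqr_ge0.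
Qed.

Fact dot_sub_eq0 n (U : {vspace chain n}) (u : subvs_of U) :
  dot (vsval u) (vsval u) = 0 -> u = 0.
Proof. by move=> /dot_eq0 u0; apply: subvs_inj; rewrite u0 linear0. Qed.

Fact dot_subB n (U : {vspace chain n}) (u v w : subvs_of U) :
  dot (vsval u) (vsval (v - w)) =
  dot (vsval u) (vsval v) - dot (vsval u) (vsval w).
Proof.
by rewrite linearB addrC -scaleN1r dot_linearr scaleN1r addrC.
Qed.

Section Adjoint.
Variables (m n : nat) (U : {vspace chain m}) (W : {vspace chain n}).

Definition is_adjoint (f : 'Hom(subvs_of U, subvs_of W))
    (g : 'Hom(subvs_of W, subvs_of U)) : Prop :=
  forall u w, dot (vsval (f u)) (vsval w) = dot (vsval u) (vsval (g w)).

(* The default 0 is never used: see [adjointP]. *)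
Definition adjoint (f : 'Hom(subvs_of U, subvs_of W)) :
    'Hom(subvs_of W, subvs_of U) :=
  xget 0 [set g | is_adjoint f g]%classic.

End Adjoint.

Lemma is_adjoint_unique m n (U : {vspace chain m}) (W : {vspace chain n})
    (f : 'Hom(subvs_of U, subvs_of W)) g1 g2 :
  is_adjoint f g1 -> is_adjoint f g2 -> g1 = g2.
Proof.
move=> h1 h2; apply/lfunP => w; apply/eqP; rewrite -subr_eq0; apply/eqP.
by apply: dot_sub_eq0; rewrite dot_subB -h1 -h2 subrr.
Qed.

(* Riesz representation on a subspace. *)
Lemma riesz n (U : {vspace chain n}) (phi : 'Hom(subvs_of U, R^o)) :
  exists u0 : subvs_of U, forall u, phi u = dot (vsval u) (vsval u0).
Proof.
pose h (u0 u : subvs_of U) : R^o := dot (vsval u0) (vsval u).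
have h_lin u0 : linear (h u0).
  by move=> a u v; rewrite /h linearP dot_linearr.
pose hL u0 := GRing.isLinear.Build _ _ _ _ (h u0) (h_lin u0).
pose H u0 : {linear subvs_of U -> R^o} := HB.pack (h u0) (hL u0).
pose r u0 : 'Hom(subvs_of U, R^o) := linfun (H u0).
have rE u0 u : r u0 u = dot (vsval u) (vsval u0).
  by rewrite lfunE /= /h dotC.
have r_lin : linear r.
  move=> a u v; apply/lfunP => w.
  by rewrite !(add_lfunE, scale_lfunE) !rE linearP dot_linearr.
pose rL := GRing.isLinear.Build _ _ _ _ r r_lin.
pose rr : {linear subvs_of U -> 'Hom(subvs_of U, R^o)} := HB.pack r rL.
have rr_inj : lker (linfun rr) == 0%VS.
  rewrite -subv0; apply/subvP => u; rewrite memv_ker lfunE /= => /eqP ru0.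
  rewrite memv0; apply/eqP/dot_sub_eq0.
  by rewrite -rE ru0 lfunE.
have full : limg (linfun rr) = fullv.
  apply/eqP; rewrite eqEdim subvf /=.
  have := limg_ker_dim (linfun rr) fullv.
  rewrite (eqP rr_inj) capv0 dimv0 add0n => ->.
  rewrite !dimvf.
  have -> : dim 'Hom(subvs_of U, R^o) = (dim (subvs_of U) * 1)%N by [].
  by rewrite muln1.
have : phi \in limg (linfun rr) by rewrite full memvf.
by case/memv_imgP => u0 _ ->; exists u0 => u; rewrite lfunE /= rE.
Qed.

Lemma adjointP m n (U : {vspace chain m}) (W : {vspace chain n})
    (f : 'Hom(subvs_of U, subvs_of W)) :
  is_adjoint f (adjoint f).
Proof.
pose phi_fun (w : subvs_of W) (u : subvs_of U) : R^o := dot (vsval w) (vsval (f u)).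
have phi_lin (w : subvs_of W) : linear (phi_fun w).
  by move=> a u v; rewrite /phi_fun !linearP dot_linearr.
pose phiL w := GRing.isLinear.Build _ _ _ _ (phi_fun w) (phi_lin w).
pose phi w : {linear subvs_of U -> R^o} := HB.pack (phi_fun w) (phiL w).
have /choice[g gP] (w : subvs_of W) : exists u0 : subvs_of U, forall u,
    dot (vsval (f u)) (vsval w) = dot (vsval u) (vsval u0).
  have [u0 u0P] := riesz (linfun (phi w)).
  by exists u0 => u; rewrite -u0P lfunE /= /phi_fun dotC.
have g_lin : linear g.
  move=> a v w; apply/eqP; rewrite -subr_eq0; apply/eqP/dot_sub_eq0.
  rewrite dot_subB -gP linearP dot_linearr linearP dot_linearr !gP.
  by rewrite subrr.
pose gL := GRing.isLinear.Build _ _ _ _ g g_lin.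
pose gg : {linear subvs_of W -> subvs_of U} := HB.pack g gL.
apply: (@xgetPex _ 0 [set g | is_adjoint f g]%classic).
by exists (linfun gg) => u w; rewrite lfunE /= gP.
Qed.

Definition bd_seq n (s : seq V) : chain n :=
  \sum_(k < n.+1) (-1) ^+ k *: epath n (omit k s).

Lemma epath_nonregular n (s : seq V) : ~~ regular s -> epath n s = 0.
Proof.
move=> /negP ns; apply/ffunP => x; rewrite !ffunE.
by case: eqP => // sE; case: ns; rewrite -sE (valP x).
Qed.

Lemma regularPn (s : seq V) : s != [::] -> ~~ regular s ->
  exists a x b, s = a ++ x :: x :: b.
Proof.
move=> s0; rewrite /regular s0 /=; elim: s {s0} => // x [|y s] // IHs.
rewrite /= negb_and negbK => /orP[/eqP ->|].
  by exists [::], y, s.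
by move=> /IHs [a [z [b ->]]]; exists (x :: a), z, b.
Qed.

Lemma nonregular_cat (a b : seq V) x : ~~ regular (a ++ x :: x :: b).
Proof.
rewrite /regular negb_and negbK; apply/orP; right; apply/negP => h.
by have := suffix_sorted (suffix_suffix a (x :: x :: b)) h; rewrite /= eqxx.
Qed.

Lemma omit_catl k (a b : seq V) : (k < size a)%N ->
  omit k (a ++ b) = omit k a ++ b.
Proof.
move=> ka; rewrite /omit takel_cat ?(ltnW ka)// drop_cat -catA.
case: ltnP => // ak; have -> : k.+1 = size a by lia.
by rewrite subnn drop0 drop_size.
Qed.

Lemma omit_catr k (a b : seq V) : omit (size a + k)%N (a ++ b) = a ++ omit k b.
Proof.
rewrite /omit take_cat drop_cat -addnS !ltnNge !leq_addr /= !addKn catA /=.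
by rewrite addnS ltnNge leq_addr.
Qed.

Lemma bd_seq_nonregular n (s : seq V) : size s = n.+1 -> ~~ regular s ->
  bd_seq n s = 0.
Proof.
move=> szs ns; have [|a [x [b sE]]] := regularPn _ ns.
  by rewrite -size_eq0 szs.
have szab : n = (size a + size b)%N.+1.
  by apply: succn_inj; rewrite -szs sE size_cat /= !addnS.
have ja : (size a < n.+1)%N by rewrite szab; lia.
have jb : ((size a).+1 < n.+1)%N by rewrite szab; lia.
rewrite /bd_seq (bigD1 (Ordinal ja)) //= (bigD1 (Ordinal jb)) /=; last first.
  by rewrite -val_eqE /= gtn_eqF.
rewrite big1 => [|i /andP[ia ib]].
  have -> : omit (size a) s = omit (size a).+1 s.
    have := omit_catr 0 a [:: x, x & b]; have := omit_catr 1 a [:: x, x & b].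
    by rewrite sE addn0 addn1 => -> ->; rewrite /omit /= drop0.
  by rewrite exprS mulN1r scaleNr addr0 subrr.
rewrite epath_nonregular ?scaler0// sE.
move: ia ib; rewrite -!val_eqE /= => ia ib.
have [lia|] := ltnP i (size a).
  by rewrite omit_catl// nonregular_cat.
move=> gia; have -> : (i = (size a + (i - size a).-2.+2)%N :> nat) by lia.
by rewrite omit_catr [omit _ _](_ : _ = x :: x :: omit (i - size a)%N.-2 b)
  ?nonregular_cat.
Qed.

Lemma bd_epath n (s : seq V) : size s = n.+1 ->
  bd n (epath n.+1 s) = bd_seq n s.
Proof.
move=> szs; have [rs|nrs] := boolP (regular s); last first.
  by rewrite epath_nonregular// linear0 bd_seq_nonregular.
have ts : size s == n.+1 by rewrite szs.
rewrite lfunE /= /bd_fun (bigD1 (exist _ (Tuple ts) rs : rpath V n.+1)) //=.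
rewrite ffunE /= eqxx scale1r [X in _ + X]big1 ?addr0 // => x xs.
rewrite ffunE; case: eqP => [xE|]; last by rewrite scale0r.
by case/eqP: xs; apply/val_inj/val_inj.
Qed.

Lemma omit_omit k l (s : seq V) : (k <= l)%N ->
  omit l (omit k s) = omit k (omit l.+1 s).
Proof.
elim: s k l => [|x s IHs] [|k] [|l] //= kl.
  by rewrite /omit /= drop0 take0 /= drop0.
- by rewrite /omit /= !drop0.
by rewrite -[LHS]/(x :: omit l (omit k s)) IHs.
Qed.

Lemma size_omit k (s : seq V) n : size s = n.+1 -> (k < n.+1)%N ->
  size (omit k s) = n.
Proof. by move=> szs kn; rewrite size_cat size_drop size_take szs kn; lia. Qed.

Lemma bd_bd_seq n (s : seq V) : size s = n.+2 -> bd n (bd_seq n.+1 s) = 0.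
Proof.
move=> szs; rewrite linear_sum /=.
pose g (k l : nat) : chain n :=
  (-1) ^+ k *: ((-1) ^+ l *: epath n (omit l (omit k s))).
transitivity (\sum_(k < n.+2) \sum_(l < n.+1) g k l).
  apply: eq_bigr => k _; rewrite linearZ /= bd_epath ?(size_omit szs)//.
  by rewrite /bd_seq scaler_sumr.
have gE (k l : nat) : (k <= l)%N -> g l.+1 k = - g k l.
  move=> kl; rewrite /g (omit_omit _ kl) !scalerA -!exprD.
  by rewrite addSn exprS mulN1r scaleNr addnC.
rewrite (eq_bigr (fun k : 'I_n.+2 => \sum_(l < n.+1 | (k <= l)%N) g k l
   + \sum_(l < n.+1 | ~~ (k <= l)%N) g k l)); last first.
  by move=> k _; rewrite (bigID (fun l : 'I_n.+1 => (k <= l)%N)).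
rewrite big_split /= big_ord_recr /= [X in _ + X + _]big1 ?addr0; last first.
  by move=> l; rewrite leqNgt ltn_ord.
rewrite [X in _ + X]big_ord_recl /= [X in _ + (X + _)]big1 // add0r.
rewrite (exchange_big_dep predT) //= -big_split big1 //= => l _.
rewrite [X in _ + X](eq_bigl (fun k : 'I_n.+1 => (k <= l)%N)); last first.
  by move=> k; rewrite /bump /= add1n -ltnNge ltnS.
rewrite -big_split big1 //= => k kl.
by rewrite /bump /= add1n gE// subrr.
Qed.

Lemma chain_epath n (u : chain n) :
  u = \sum_(x : rpath V n) u x *: epath n (val (val x)).
Proof.
apply/ffunP => y; rewrite sum_ffunE (bigD1 y) //= !ffunE eqxx /= big1 ?addr0.
  by rewrite [RHS]mulr1.
move=> x xy; rewrite !ffunE; case: eqP => [yx|]; last by rewrite scaler0.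
by case/eqP: xy; apply/esym/val_inj/val_inj.
Qed.

Lemma bd_bd n (u : chain n.+2) : bd n (bd n.+1 u) = 0.
Proof.
rewrite (chain_epath u) !linear_sum big1 //= => x _.
by rewrite !linearZ /= bd_epath ?size_tuple// bd_bd_seq ?scaler0 ?size_tuple.
Qed.

Variable E : rel V.

(* The span of the allowed paths.  For irreflexive E the paths sorted for E
   are regular, so quantifying over regular paths loses nothing. *)
Definition allowed_chains n : {vspace chain n} :=
  <<[seq epath n (val (val x)) | x in
       [pred x : rpath V n | sorted E (val (val x))]]>>%VS.

Definition Omega (n : nat) : {vspace chain n} :=
  match n with
  | 0 => 0%VS
  | m.+1 => (allowed_chains m.+1 :&: (bd m @^-1: allowed_chains m))%VS
  end.

(* The boundary restricted to Omega.  Since bd maps [Omega n.+1] into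
   [Omega n], [vsproj] only retypes its argument: see [bd_OmegaE]. *)
Definition bd_Omega n : 'Hom(subvs_of (Omega n.+1), subvs_of (Omega n)) :=
  linfun (vsproj (Omega n) \o bd n \o vsval).

Lemma bd_OmegaE n (u : subvs_of (Omega n.+1)) :
  vsval (bd_Omega n u) = bd n (vsval u).
Proof.
rewrite lfunE /= vsprojK//; have := subvsP u.
case: n u => [|n] u; rewrite /= memv_cap -memv_preim => /andP[_ uA].
  have v0 (v : chain 0) : v = 0 by apply/ffunP => -[[[|//] sz] //].
  by rewrite (v0 (bd _ _)) mem0v.
by rewrite memv_cap uA -memv_preim bd_bd mem0v.
Qed.

(* The Laplacian on p-chains, which have p + 1 vertices. *)
Definition hodge_laplacian (p : nat) : 'End(subvs_of (Omega p.+1)) :=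
  ((bd_Omega p.+1 \o adjoint (bd_Omega p.+1))
   + (adjoint (bd_Omega p) \o bd_Omega p))%VF.

End PathSpaces.

(* The spectrum of A is finite, so this is the maximal eigenvalue of A as soon
   as A has an eigenvalue (see [lambda_maxP]), in particular for every
   self-adjoint A on a nonzero space; on the zero space its value is 0. *)
Definition lambda_max (R : realType) (vT : vectType R) (A : 'End(vT)) : R :=
  sup [set l | passmx.leigenvalue A l]%classic.

Lemma poly_roots_finite (R : fieldType) (p : {poly R}) :
  p != 0 -> exists rs : seq R, forall a, root p a -> a \in rs.
Proof.
have [n] := ubnP (size p); elim: n p => // n IHn p /ltnSE-szp p0.
have [[a pa]|npa] := pselect (exists a, root p a); last first.
  by exists [::] => a pa; case: npa; exists a.
have /factor_theorem[q pE] := pa.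
have q0 : q != 0 by apply: contraNneq p0 => q0; rewrite pE q0 mul0r.
have [|//|rs rsP] := IHn q.
  by rewrite (leq_trans _ szp)// pE size_Mmonic ?monicXsubC// size_XsubC addn2.
exists (a :: rs) => b; rewrite pE rootM root_XsubC inE orbC.
by case/orP => [->//|/rsP ->]; rewrite orbT.
Qed.

Lemma lambda_maxP (R : realType) (vT : vectType R) (A : 'End(vT)) (l : R) :
  passmx.leigenvalue A l ->
  passmx.leigenvalue A (lambda_max A) /\ l <= lambda_max A.
Proof.
move=> Al; pose e := vbasis {:vT}; pose M := passmx.mxof e e A.
have rootM a : passmx.leigenvalue A a -> root (char_poly M) a.
  rewrite -eigenvalue_root_char /passmx.leigenvalue /eigenvalue.
  by rewrite (passmx.leigenspaceE (vbasisP _)) passmx.vsof_eq0 ?vbasisP.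
have [rs rsP] : exists rs : seq R, forall a, root (char_poly M) a -> a \in rs.
  by apply: poly_roots_finite; rewrite monic_neq0 ?char_poly_monic.
pose b := \big[Num.max/l]_(a <- rs | passmx.leigenvalue A a) a.
have Ab : passmx.leigenvalue A b.
  by apply: (big_ind (passmx.leigenvalue A)) => // x y Ax Ay; case: (leP x y).
have leb a : passmx.leigenvalue A a -> a <= b.
  by move=> Aa; apply: le_bigmax_seq => //; apply/rsP/rootM.
suff -> : lambda_max A = b by split=> //; apply: leb.
apply/eqP; rewrite eq_le; apply/andP; split.
  by apply: ge_sup; [exists l | move=> a; apply: leb].
by apply: ub_le_sup => //; exists b => a; apply: leb.
Qed.

(* Main.v *)
Require Import Defs.
From HB Require Import structures.
From mathcomp Require Import all_boot all_order all_algebra.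
From mathcomp Require Import boolp classical_sets reals.
From mathcomp Require Import ring lra zify.

Set Implicit Arguments.
Unset Strict Implicit.
Unset Printing Implicit Defensive.

(** Why the bound holds.  Let [u] be an eigenvector of the Laplacian on 1-chains
    for the eigenvalue [l], and write d for the boundary, d* for its adjoint.
    Since d d = 0, either [u] has nonzero boundary [f], and then [f] is an
    eigenvector of d d* on 0-chains for the same [l], or d [u] = 0, and then
    [u] is an eigenvector of d d* on 1-chains.  In both cases [l] is at most
    the square of the norm of d between two consecutive degrees
    ([hodge_eigenvalue_le]).  A bound [M] on the square of that norm is best
    used in the polarized form
      2 <x, d y>  <=  <y, y> + M <x, x>,
    which is what gets proved at both levels.

    From 1-chains to 0-chains, <f, d g> is the sum of g_ij (f_j - f_i) over
    arrows; completing squares leaves 2 (f_i^2 + f_j^2) for each arrow, hence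
    2 deg(i) f_i^2 for each vertex ([vertex_level_bound]).

    From 2-chains to 1-chains, <u, d v> is the sum of
    v_ijk (u_jk - u_ik + u_ij) over allowed paths ijk.  A path with i -> k is
    a triangle and costs three times the sum of the squares of [u] on its three
    arrows.  When i -> k is not an arrow, the condition that d v is allowed says
    that the v_ijk with fixed ends sum to 0 over the intermediate vertex j;
    without multisquares there are at most two such j, so either these
    coefficients vanish, or there are two opposite ones, belonging to a square,
    and the pair costs twice the sum of the squares of [u] on its four arrows
    ([path_form_square]).  Exchanging the sums over figures and over arrows
    turns these costs into 3 deg_triangle + 2 deg_square
    ([edge_form_bound], [edge_level_bound]).  Double arrows are excluded so
    that the two ends of an allowed 2-path are distinct. *)

Import Order.TTheory GRing.Theory Num.Theory.
Local Open Scope ring_scope.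

(** * Degrees and double counting *)

Section Counting.
Variable R : realType.

(** Double counting of the incident pairs: the three kinds of degree are all of
    the form on the left. *)
Lemma sum_incidence (I J : finType) (P : pred J) (Q : I -> J -> bool)
    (F : I -> R) :
  \sum_x #|[set y | P y & Q x y]|%:R * F x =
  \sum_(y | P y) \sum_(x | Q x y) F x.
Proof.
rewrite [RHS](exchange_big_dep predT) //=; apply: eq_bigr => x _.
by rewrite sumr_const -[in RHS]cardsE mulr_natl.
Qed.

Lemma sum_bounded_weight (I : finType) (P : pred I) (d : I -> nat)
    (F : I -> R) :
    (forall x, 0 <= F x) -> (forall x, ~~ P x -> F x = 0) ->
  \sum_x (d x)%:R * F x <= (\max_(x | P x) d x)%:R * \sum_x F x.
Proof.
move=> F0 FP; rewrite mulr_sumr; apply: ler_sum => x _.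
have [Px|/FP->] := boolP (P x); last by rewrite !mulr0.
by rewrite ler_wpM2r// ler_nat leq_bigmax_cond.
Qed.

End Counting.

Section Combinatorics.
Variables (R : realType) (V : finType) (E : rel V).

Definition middles (i k : V) : {set V} := [set j | E i j & E j k].

Lemma arrow_neq i j : irreflexive E -> E i j -> i != j.
Proof. by move=> irr; apply: contraTneq => ->; rewrite irr. Qed.

Lemma arrow_antisym i j : irreflexive E -> no_double_arrows E ->
  E i j -> ~~ E j i.
Proof.
move=> irr nod ij; have := nod i j.
by rewrite /double_arrow (arrow_neq irr ij) ij.
Qed.

(** Three or more intermediate vertices would make [i], [middles i k], [k] a
    multisquare. *)
Lemma card_middles i k : irreflexive E -> no_double_arrows E ->
  no_multisquares E -> ~~ E i k -> (#|middles i k| <= 2)%N.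
Proof.
move=> irr nod nom nik; rewrite leqNgt; apply/negP => c3.
have sz : size (enum (middles i k)) == #|middles i k|.-1.+1.
  by rewrite -cardE prednK // (ltn_trans _ c3).
have /negP := nom #|middles i k|.-1 i (Tuple sz) k; apply.
have memM j : (j \in Tuple sz) = E i j && E j k.
  by rewrite memtE /= mem_enum inE.
have ink : i != k.
  apply/eqP => ik; have /card_gt0P[j] : (0 < #|middles i k|)%N by lia.
  rewrite inE ik => /andP[kj jk].
  by have := arrow_antisym irr nod kj; rewrite jk.
apply/and4P; split=> //; first by rewrite -ltnS prednK // (ltn_trans _ c3).
  rewrite /= mem_rcons inE negb_or ink rcons_uniq enum_uniq andbT /=.
  by rewrite !mem_enum !inE !irr andbF.
by apply/forallP => j; rewrite -memM mem_tnth.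
Qed.

Lemma square_middles i k : irreflexive E -> no_double_arrows E ->
  ~~ E i k -> #|middles i k| == 2 -> square E (i, middles i k, k).
Proof.
move=> irr nod nik /cards2P[j [j' [jj' M]]].
have := set21 j j'; have := set22 j j'.
rewrite -M !inE => /andP[ij' j'k] /andP[ij jk].
apply/existsP; exists j; apply/existsP; exists j'.
rewrite M eqxx ij jk ij' j'k nik /= !inE !negb_or jj' !andbT /=.
rewrite !(arrow_neq irr ij, arrow_neq irr ij').
rewrite !(arrow_neq irr jk, arrow_neq irr j'k) /= ?andbT; apply/eqP => ik.
by have := arrow_antisym irr nod ij; rewrite ik jk.
Qed.

Lemma sum_deg (irr : irreflexive E) (f : V -> R) :
  \sum_i (deg E i)%:R * f i = \sum_(xi | arrow E xi) (f xi.1 + f xi.2).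
Proof.
rewrite sum_incidence; apply: eq_bigr => -[i j] /(arrow_neq irr) /= ij.
transitivity (\sum_(x <- [:: i; j]) f x); last first.
  by rewrite !big_cons big_nil addr0.
rewrite big_uniq /= ?inE ?ij //; apply: eq_bigl => x.
by rewrite !inE (eq_sym i) (eq_sym j).
Qed.

Lemma sum_deg_triangle (irr : irreflexive E) (w : V * V -> R) :
  \sum_xi (deg_triangle E xi)%:R * w xi =
  \sum_(t | triangle E t) (w (t.1.1, t.1.2) + w (t.1.2, t.2) + w (t.1.1, t.2)).
Proof.
rewrite sum_incidence; apply: eq_bigr => -[[i j] k] /and4P[+ ij jk ik] /=.
rewrite /= !inE negb_or !andbT -andbA => /and3P[nij nik njk].
rewrite -big_uniq /= ?big_cons ?big_nil ?addr0 ?addrA // !inE !xpair_eqE.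
by rewrite (eq_sym j i) (negPf nij) (negPf njk) ?andbF.
Qed.

(** The pairs of ends [(i, k)] inject into the squares by
    [(i, middles i k, k)], which is enough for the inequality. *)
Lemma sum_deg_square (irr : irreflexive E) (nod : no_double_arrows E)
    (w : V * V -> R) : (forall xi, 0 <= w xi) ->
  \sum_i \sum_(k | ~~ E i k && (#|middles i k| == 2))
     \sum_(j in middles i k) (w (i, j) + w (j, k)) <=
  \sum_xi (deg_square E xi)%:R * w xi.
Proof.
move=> w0; rewrite sum_incidence pair_big_dep /=.
pose h (p : V * V) := (p.1, middles p.1 p.2, p.2).
pose D := [set p : V * V | ~~ E p.1 p.2 && (#|middles p.1 p.2| == 2)].
pose G q := \sum_(xi | square_contains xi q) w xi.
have h_inj : injective h by move=> [a b] [c d] [-> _ ->].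
have -> : \sum_(q | square E q) G q = \sum_(q in [set q | square E q]) G q.
  by apply: eq_bigl => q; rewrite inE.
have hD : h @: D \subset [set q | square E q].
  apply/fintype.subsetP => _ /imsetP[[i k] + ->]; rewrite !inE => /andP[nik M2].
  exact: square_middles.
rewrite (big_setID (h @: D)) /= (finset.setIidPr hD).
apply: ler_wpDr; first by apply: sumr_ge0 => q _; apply: sumr_ge0.
rewrite big_imset /=; last by move=> x y _ _ /h_inj.
rewrite (eq_bigl [in D]); last by move=> p; rewrite inE.
apply: ler_sum => -[i k] _; rewrite /G /h /= big_split /=.
have eta (P : pred (V * V)) :
    \sum_(xi | P xi) w xi = \sum_(xi | P xi) w (xi.1, xi.2).
  by apply: eq_bigr => -[].
have -> : \sum_(j in middles i k) w (i, j) =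
    \sum_(xi | (xi.1 == i) && (xi.2 \in middles i k)) w xi.
  rewrite eta -(pair_big (pred1 i) (mem (middles i k))
    (fun a b => w (a, b))) /=.
  by rewrite big_pred1_eq.
have -> : \sum_(j in middles i k) w (j, k) =
    \sum_(xi | (xi.1 \in middles i k) && (xi.2 == k)) w xi.
  rewrite eta -(pair_big (mem (middles i k)) (pred1 k)
    (fun a b => w (a, b))) /=.
  by apply: eq_bigr => j _; rewrite big_pred1_eq.
(* The two conditions exclude each other, since i is not in [middles i k]. *)
rewrite big_mkcond [X in _ + X]big_mkcond [leRHS]big_mkcond -big_split /=.
apply: ler_sum => -[a b] _ /=; have [->|_] := eqVneq a i; last by rewrite add0r.
have iM : i \notin middles i k by rewrite inE irr.
by rewrite (negPf iM) /= addr0 orbF.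
Qed.

(** * The two quadratic forms *)

(** The contribution of the paths from [i] to [k] when there is no arrow from
    [i] to [k].  With two intermediate vertices the coefficients are [x] and
    [- x], and 2 x (g - g') <= 2 x^2 + (g - g')^2 / 2, where g - g' is a signed
    sum of four terms; with at most one, the coefficients are 0. *)
Lemma path_form_square (irr : irreflexive E) (nod : no_double_arrows E)
    (nom : no_multisquares E) i k (a b v : V -> R) : ~~ E i k ->
    (forall j, j \notin middles i k -> v j = 0) -> \sum_j v j = 0 ->
  2 * \sum_j v j * (a j + b j) <= \sum_j v j ^+ 2 +
    (#|middles i k| == 2)%:R *
      (2 * \sum_(j in middles i k) (a j ^+ 2 + b j ^+ 2)).
Proof.
move=> nik v0 sv.
have red (F : V -> R) : (forall j, v j = 0 -> F j = 0) ->
    \sum_j F j = \sum_(j in middles i k) F j.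
  move=> F0; rewrite [RHS]big_mkcond; apply: eq_bigr => j _.
  by case: ifPn => // /v0/F0.
rewrite (red (fun j => v j * _)) => [|j ->]; last by rewrite mul0r.
rewrite (red (fun j => v j ^+ 2)) => [|j ->]; last by rewrite expr0n.
move: sv; rewrite (red v) //; have := card_middles irr nod nom nik.
rewrite leq_eqVlt; case: eqP => /= [/eqP/cards2P[j [j' [jj' ->]]] _|_].
  rewrite !big_setU1 ?inE//= !big_set1 mul1r => vs.
  have -> : v j' = - v j by lra.
  have := sqr_ge0 (2 * v j - (a j + b j - a j' - b j')).
  have := sqr_ge0 (a j - b j); have := sqr_ge0 (a j' - b j').
  have := sqr_ge0 (a j + b j + a j' + b j'); lra.
rewrite ltnS leq_eqVlt ltnS leqn0 cards_eq0 => /orP[/cards1P[j ->]|/eqP->].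
  by rewrite !big_set1 => ->; rewrite mul0r expr0n mul0r !mulr0 addr0.
by rewrite !big_set0 mul0r mulr0 addr0.
Qed.

End Combinatorics.

Section Forms.
Variables (R : realType) (V : finType) (E : rel V).
Hypotheses (irr : irreflexive E) (nod : no_double_arrows E).

Lemma vertex_form_bound (f : V -> R) (g : V -> V -> R) :
    (forall i j, ~~ E i j -> g i j = 0) ->
  2 * \sum_i \sum_j g i j * (f j - f i) <=
  \sum_i \sum_j g i j ^+ 2 + (2 * \max_i deg E i)%:R * \sum_i f i ^+ 2.
Proof.
move=> g0; rewrite natrM -mulrA.
apply: (@le_trans _ _ (\sum_i \sum_j g i j ^+ 2 +
    2 * \sum_(xi | arrow E xi) (f xi.1 ^+ 2 + f xi.2 ^+ 2))); last first.
  rewrite lerD2l ler_pM2l // -(sum_deg irr (fun i => f i ^+ 2)).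
  by apply: sum_bounded_weight => // i; apply: sqr_ge0.
rewrite !pair_bigA /= [X in _ + 2 * X]big_mkcond !mulr_sumr -big_split /=.
apply: ler_sum => -[i j] _ /=; rewrite /arrow /=.
case: ifPn => [_|/g0 ->]; last by rewrite mul0r expr0n !mulr0 addr0.
have := sqr_ge0 (g i j - (f j - f i)); have := sqr_ge0 (f j + f i); lra.
Qed.

(** Grouping the paths [ijk] by their ends [(i, k)] separates triangles from
    squares and makes the vanishing sums available.  [T] and [S] below are the
    costs of a triangle and of a pair of ends of a square. *)
Lemma edge_form_bound (nom : no_multisquares E)
    (u : V -> V -> R) (v : V -> V -> V -> R) :
    (forall i j, ~~ E i j -> u i j = 0) ->
    (forall i j k, ~~ (E i j && E j k) -> v i j k = 0) ->
    (forall i k, ~~ E i k -> \sum_j v i j k = 0) ->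
  2 * \sum_i \sum_j \sum_k v i j k * (u j k - u i k + u i j) <=
  \sum_i \sum_j \sum_k v i j k ^+ 2 +
  (\max_(xi | arrow E xi) (3 * deg_triangle E xi + 2 * deg_square E xi))%:R
    * \sum_i \sum_j u i j ^+ 2.
Proof.
move=> u0 v0 sv; pose w (xi : V * V) := u xi.1 xi.2 ^+ 2.
pose T i j k := (triangle E (i, j, k))%:R
  * (w (i, j) + w (j, k) + w (i, k)).
pose S i k := (~~ E i k && (#|middles E i k| == 2))%:R
  * \sum_(j in middles E i k) (w (i, j) + w (j, k)).
have w_ge0 xi : 0 <= w xi by apply: sqr_ge0.
have pair_form i k : 2 * \sum_j v i j k * (u j k - u i k + u i j) <=
    \sum_j v i j k ^+ 2 + (3 * \sum_j T i j k + 2 * S i k).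
  have [ik|nik] := boolP (E i k).
    rewrite /S ik mul0r mulr0 addr0 !mulr_sumr -big_split /=.
    apply: ler_sum => j _.
    have [/andP[ij jk]|/v0->] := boolP (E i j && E j k); last first.
      by rewrite mul0r expr0n mulr0 add0r !mulr_ge0 // !addr_ge0.
    rewrite /T /triangle /= ij jk ik !inE negb_or !(arrow_neq irr) //=.
    rewrite mul1r /w /=.
    have := sqr_ge0 (v i j k - (u j k - u i k + u i j)).
    have := sqr_ge0 (u j k + u i k); have := sqr_ge0 (u j k - u i j).
    have := sqr_ge0 (u i k + u i j); lra.
  have T0 : 0 <= \sum_j T i j k.
    by apply: sumr_ge0 => j _; rewrite mulr_ge0 // !addr_ge0.
  apply: (@le_trans _ _ (\sum_j v i j k ^+ 2 + 2 * S i k)); last first.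
    by rewrite lerD2l lerDr mulr_ge0.
  rewrite (u0 i k nik) /S nik /= mulrCA.
  have := path_form_square irr nod nom (u i) (u^~ k) nik
    (v := fun j => v i j k).
  under [in X in (_ -> _ -> X) -> _]eq_bigr do rewrite addrC.
  under [in X in _ -> X]eq_bigr do rewrite subr0.
  apply; last exact: sv.
  by move=> j; rewrite inE; apply: v0.
have sumT : \sum_i \sum_k \sum_j T i j k =
    \sum_xi (deg_triangle E xi)%:R * w xi.
  rewrite (sum_deg_triangle irr) [RHS]big_mkcond.
  transitivity (\sum_i \sum_j \sum_k T i j k).
    by apply: eq_bigr => i _; rewrite exchange_big.
  rewrite pair_bigA pair_bigA /=; apply: eq_bigr => -[[i j] k] _.
  transitivity (T i j k) => //; rewrite /T.
  by case: (triangle E (i, j, k)); rewrite ?mul1r ?mul0r.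
have sumS : \sum_i \sum_k S i k <= \sum_xi (deg_square E xi)%:R * w xi.
  apply: le_trans (sum_deg_square irr nod w_ge0); apply: ler_sum => i _.
  rewrite [leRHS]big_mkcond; apply: ler_sum => k _; rewrite /S.
  by case: ifP => _; rewrite ?mul1r ?mul0r.
have bound : 3 * \sum_i \sum_k \sum_j T i j k + 2 * \sum_i \sum_k S i k <=
    (\max_(xi | arrow E xi) (3 * deg_triangle E xi + 2 * deg_square E xi))%:R
      * \sum_xi w xi.
  apply: le_trans (sum_bounded_weight _ w_ge0 _); last first.
    by move=> -[i j] /u0; rewrite /w /= => ->; rewrite expr0n.
  apply: (@le_trans _ _ (3 * \sum_xi (deg_triangle E xi)%:R * w xi +
      2 * \sum_xi (deg_square E xi)%:R * w xi)).
    by rewrite sumT lerD2l ler_pM2l.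
  rewrite !mulr_sumr -big_split /=; apply: ler_sum => xi _.
  by rewrite /= natrD !natrM [leRHS]mulrDl !mulrA.
rewrite [X in _ + _ * X]pair_bigA /=.
apply: le_trans _ (lerD (lexx _) bound).
rewrite !mulr_sumr -!big_split /=; apply: ler_sum => i _.
rewrite exchange_big [X in _ <= X + _]exchange_big !mulr_sumr -!big_split /=.
apply: ler_sum => k _; apply: pair_form.
Qed.

End Forms.

(** * Chains in coordinates *)

Section Chains.
Variables (R : realType) (V : finType).

(** The coefficient of a chain at an arbitrary sequence, 0 if the sequence is
    not regular.  Sums over regular paths thereby become sums over all tuples,
    which unfold into iterated sums over vertices. *)
Definition coef n (u : chain R V n) (s : seq V) : R := dot u (epath R n s).

Lemma dotZr n (u v : chain R V n) a : dot u (a *: v) = a * dot u v.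
Proof. by rewrite mulr_sumr; apply: eq_bigr => x _; rewrite ffunE mulrCA. Qed.

Lemma dot_sumr n (u : chain R V n) (I : finType) (F : I -> chain R V n) :
  dot u (\sum_i F i) = \sum_i dot u (F i).
Proof.
rewrite exchange_big; apply: eq_bigr => x _.
by rewrite sum_ffunE mulr_sumr.
Qed.

Lemma coefE n (u : chain R V n) (x : rpath V n) : coef u (val (val x)) = u x.
Proof.
rewrite /coef /dot (bigD1 x) //= ffunE eqxx mulr1 big1 ?addr0 // => y yx.
rewrite ffunE; case: eqP => [yE|]; last by rewrite mulr0.
by case/eqP: yx; apply/val_inj/val_inj.
Qed.

Lemma coef_epath n s t : regular s -> size s = n ->
  coef (epath R n s : chain R V n) t = (s == t)%:R.
Proof.
move=> rs /eqP szs; rewrite /coef dotC -/(coef _ _).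
by rewrite -[s in coef _ s]/(val (val (exist _ (Tuple szs) rs : rpath V n)))
  coefE ffunE.
Qed.

Lemma coef_nonregular n (u : chain R V n) s : ~~ regular s -> coef u s = 0.
Proof.
move=> ns; rewrite /coef epath_nonregular // /dot big1 // => x _.
by rewrite ffunE mulr0.
Qed.

Lemma sum_rpath n (F : seq V -> R) : (forall s, ~~ regular s -> F s = 0) ->
  \sum_(x : rpath V n) F (val (val x)) = \sum_(t : n.-tuple V) F t.
Proof.
move=> F0; rewrite [RHS](bigID (fun t : n.-tuple V => regular t)) /=.
rewrite [X in _ + X]big1 ?addr0 => [|t /F0//].
exact: (esym (big_sub (fun t : n.-tuple V => regular t) (fun t => F t))).
Qed.

Lemma sum_tuple0 (F : seq V -> R) : \sum_(t : 0.-tuple V) F t = F [::].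
Proof.
by rewrite (big_pred1 [tuple]) // => t; apply/esym/eqP; apply: tuple0.
Qed.

Lemma sum_tupleS n (F : seq V -> R) :
  \sum_(t : n.+1.-tuple V) F t = \sum_i \sum_(t : n.-tuple V) F (i :: t).
Proof.
rewrite pair_bigA /=.
rewrite (reindex (fun p : V * n.-tuple V => cons_tuple p.1 p.2)) //=.
exists (fun t : n.+1.-tuple V => (thead t, behead_tuple t)) => [[x t] _|t _] /=.
  by congr pair; apply: val_inj.
by rewrite [RHS]tuple_eta; apply: val_inj.
Qed.

Lemma sum_tuple1 (F : seq V -> R) :
  \sum_(t : 1.-tuple V) F t = \sum_i F [:: i].
Proof.
rewrite (@sum_tupleS 0 F); apply: eq_bigr => i _.
exact: (sum_tuple0 (fun s => F (i :: s))).
Qed.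

Lemma sum_tuple2 (F : seq V -> R) :
  \sum_(t : 2.-tuple V) F t = \sum_i \sum_j F [:: i; j].
Proof.
rewrite (@sum_tupleS 1 F); apply: eq_bigr => i _.
exact: (sum_tuple1 (fun s => F (i :: s))).
Qed.

Lemma sum_tuple3 (F : seq V -> R) :
  \sum_(t : 3.-tuple V) F t = \sum_i \sum_j \sum_k F [:: i; j; k].
Proof.
rewrite (@sum_tupleS 2 F); apply: eq_bigr => i _.
exact: (sum_tuple2 (fun s => F (i :: s))).
Qed.

Lemma dot_coef n (u v : chain R V n) :
  dot u v = \sum_(t : n.-tuple V) coef u t * coef v t.
Proof.
rewrite -(@sum_rpath _ (fun s => coef u s * coef v s)).
  by apply: eq_bigr => x _; rewrite !coefE.
by move=> s ns; rewrite coef_nonregular ?mul0r.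
Qed.

(** Pairing the boundary with a chain moves the omission of vertices to that
    chain, so its values on paths need not be collected. *)
Lemma dot_bd n (u : chain R V n) (v : chain R V n.+1) :
  dot u (bd R V n v) = \sum_(t : n.+1.-tuple V)
    coef v t * \sum_(k < n.+1) (-1) ^+ k * coef u (omit k t).
Proof.
rewrite -(@sum_rpath _ (fun s => coef v s *
   \sum_(k < n.+1) (-1) ^+ k * coef u (omit k s))); last first.
  by move=> s ns; rewrite coef_nonregular ?mul0r.
rewrite lfunE /= /bd_fun dot_sumr; apply: eq_bigr => x _.
rewrite dotZr coefE dot_sumr; congr (_ * _); apply: eq_bigr => k _.
by rewrite dotZr.
Qed.

Lemma dot1E (f : chain R V 1) : dot f f = \sum_i coef f [:: i] ^+ 2.
Proof. by rewrite dot_coef (sum_tuple1 (fun s => coef f s * coef f s)). Qed.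

Lemma dot2E (u : chain R V 2) :
  dot u u = \sum_i \sum_j coef u [:: i; j] ^+ 2.
Proof. by rewrite dot_coef (sum_tuple2 (fun s => coef u s * coef u s)). Qed.

Lemma dot3E (v : chain R V 3) :
  dot v v = \sum_i \sum_j \sum_k coef v [:: i; j; k] ^+ 2.
Proof. by rewrite dot_coef (sum_tuple3 (fun s => coef v s * coef v s)). Qed.

Lemma dot_bd1 (f : chain R V 1) (g : chain R V 2) :
  dot f (bd R V 1 g) =
    \sum_i \sum_j coef g [:: i; j] * (coef f [:: j] - coef f [:: i]).
Proof.
rewrite dot_bd (sum_tuple2 (fun s => coef g s *
  \sum_(k < 2) (-1) ^+ k * coef f (omit k s))).
apply: eq_bigr => i _; apply: eq_bigr => j _; congr (_ * _).
by rewrite !big_ord_recl big_ord0 /omit /= expr0 expr1; ring.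
Qed.

Lemma dot_bd2 (u : chain R V 2) (v : chain R V 3) :
  dot u (bd R V 2 v) = \sum_i \sum_j \sum_k coef v [:: i; j; k] *
    (coef u [:: j; k] - coef u [:: i; k] + coef u [:: i; j]).
Proof.
rewrite dot_bd (sum_tuple3 (fun s => coef v s *
  \sum_(k < 3) (-1) ^+ k * coef u (omit k s))).
apply: eq_bigr => i _; apply: eq_bigr => j _; apply: eq_bigr => k _.
congr (_ * _).
by rewrite !big_ord_recl big_ord0 /omit /= expr0 expr1; ring.
Qed.

Lemma coef_allowed (E : rel V) n (u : chain R V n) s :
  u \in allowed_chains R E n -> ~~ sorted E s -> coef u s = 0.
Proof.
move=> uA ns.
pose L := GRing.isLinear.Build _ _ _ _ (dot (epath R n s) : _ -> R^o)
  (dot_linearr (epath R n s)).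
pose D : {linear chain R V n -> R^o} :=
  HB.pack (dot (epath R n s) : _ -> R^o) L.
have sub : (allowed_chains R E n <= lker (linfun D))%VS.
  apply/span_subvP => _ /fintype.imageP[x xE ->].
  rewrite memv_ker lfunE -[D _]/(dot _ _) dotC; apply/eqP.
  rewrite [LHS]big1 // => y _; rewrite !ffunE.
  have [sy|_] := eqVneq (val (val y)) s; last by rewrite mulr0.
  rewrite sy; have [sx|_] := eqVneq s (val (val x)); last by rewrite mul0r.
  by move: ns; rewrite sx; move/negP; case.
move/subvP: sub => /(_ u uA).
by rewrite memv_ker lfunE -[D _]/(dot _ _) dotC => /eqP.
Qed.

(** * Eigenvalues of the Laplacian *)

Lemma dot_gt0 n (U : {vspace chain R V n}) (w : subvs_of U) :
  w != 0 -> 0 < dot (vsval w) (vsval w).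
Proof.
move=> w0; rewrite lt_def; apply/andP; split.
  by apply: contra_neq w0 => /dot_sub_eq0.
by apply: sumr_ge0 => x _; rewrite -expr2 sqr_ge0.
Qed.

(** The form bound is applied to [v := adjoint d w], for which
    <w, d v> = <v, v> = l <w, w>. *)
Lemma adjoint_eigenvalue_le m n (U : {vspace chain R V m})
    (W : {vspace chain R V n}) (d : 'Hom(subvs_of U, subvs_of W)) (M l : R)
    (w : subvs_of W) :
    (forall v, 2 * dot (vsval w) (vsval (d v)) <=
      dot (vsval v) (vsval v) + M * dot (vsval w) (vsval w)) ->
  w != 0 -> d (adjoint d w) = l *: w -> l <= M.
Proof.
move=> /(_ (adjoint d w)) bound w0 dw.
rewrite -(ler_pM2r (dot_gt0 w0)).
have dwE : dot (vsval w) (vsval (d (adjoint d w))) =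
    l * dot (vsval w) (vsval w).
  by rewrite dw linearZ dotZr.
have := adjointP d (adjoint d w) w; rewrite dotC dwE => vE.
by move: bound; rewrite dwE -vE; lra.
Qed.

(** If the boundary of an eigenvector [u] vanishes, [u] is an eigenvector of the
    upper summand of the Laplacian.  Otherwise applying the boundary to the
    eigenvalue equation kills the upper summand, and the boundary of [u] is an
    eigenvector one degree lower. *)
Lemma hodge_eigenvalue_le (E : rel V) p (M N l : R) :
    (forall f g, f \in Omega R E p -> g \in Omega R E p.+1 ->
      2 * dot f (bd R V p g) <= dot g g + M * dot f f) ->
    (forall u v, u \in Omega R E p.+1 -> v \in Omega R E p.+2 ->
      2 * dot u (bd R V p.+1 v) <= dot v v + N * dot u u) ->
  passmx.leigenvalue (hodge_laplacian R E p) l -> l <= Num.max M N.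
Proof.
move=> HM HN; rewrite /passmx.leigenvalue -vpick0.
move: (vpick _) (memv_pick (passmx.leigenspace (hodge_laplacian R E p) l)) => u.
rewrite memv_ker !(add_lfunE, opp_lfunE, scale_lfunE, id_lfunE, comp_lfunE).
rewrite subr_eq0 => /eqP uE u0.
pose A := bd_Omega R E p.+1; pose B := bd_Omega R E p.
have BA v : B (A v) = 0.
  by apply: subvs_inj; rewrite !bd_OmegaE bd_bd linear0.
rewrite -/A -/B in uE; rewrite le_max; apply/orP.
have [Bu0|Bu0] := eqVneq (B u) 0; [right|left].
  apply: (adjoint_eigenvalue_le _ u0 (d := A)) => [v|].
    by rewrite bd_OmegaE; apply: HN; apply: subvsP.
  by rewrite -uE Bu0 linear0 addr0.
apply: (adjoint_eigenvalue_le _ Bu0 (d := B)) => [v|].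
  by rewrite (bd_OmegaE v); apply: HM; apply: subvsP.
by rewrite -[RHS]linearZ -uE linearD /= BA add0r.
Qed.

End Chains.

(** * The boundary between vertices, arrows and 2-paths *)

Section Levels.
Variables (R : realType) (V : finType) (E : rel V).
Hypotheses (irr : irreflexive E) (nod : no_double_arrows E).

Lemma vertex_level_bound (f : chain R V 1) (g : chain R V 2) :
    g \in Omega R E 2 ->
  2 * dot f (bd R V 1 g) <=
    dot g g + (2 * \max_i deg E i)%:R * dot f f.
Proof.
rewrite memv_cap => /andP[gA _]; rewrite dot_bd1 dot1E dot2E.
apply: (vertex_form_bound irr (fun i => coef f [:: i])
  (g := fun i j => coef g [:: i; j])) => i j nij.
by rewrite (coef_allowed gA) //= andbT.
Qed.

Lemma edge_level_bound (nom : no_multisquares E)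
    (u : chain R V 2) (v : chain R V 3) :
    u \in Omega R E 2 -> v \in Omega R E 3 ->
  2 * dot u (bd R V 2 v) <= dot v v +
    (\max_(xi | arrow E xi) (3 * deg_triangle E xi + 2 * deg_square E xi))%:R
      * dot u u.
Proof.
rewrite !memv_cap -memv_preim => /andP[uA _] /andP[vA bdvA].
rewrite dot_bd2 dot2E dot3E.
have v0 i j k : ~~ (E i j && E j k) -> coef v [:: i; j; k] = 0.
  by move=> nijk; rewrite (coef_allowed vA) //= andbT.
apply: (edge_form_bound irr nod nom (u := fun i j => coef u [:: i; j])
  (v := fun i j k => coef v [:: i; j; k])) => [i j nij|//|i k nik].
  by rewrite (coef_allowed uA) //= andbT.
(* For i = k there is no allowed path; otherwise the sum is, up to sign, the
   coefficient of d v at the path ik, which is regular but not allowed. *)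
have [ik|ik] := eqVneq i k.
  rewrite big1 // => j _; rewrite v0 // ik negb_and -implybE.
  by apply/implyP => kj; apply: arrow_antisym.
move: bdvA; rewrite -memv_preim => bdvA.
have := coef_allowed (s := [:: i; k]) bdvA; rewrite /= andbT => /(_ nik).
rewrite [coef (bd _ _ _ _) _]dotC dot_bd2 => bd0.
rewrite -[RHS]oppr0 -[in RHS]bd0.
have eik : regular [:: i; k] by rewrite /regular /= ik.
(* Neither ab nor bc can be the path ik, because they are arrows; only the
   omission of the intermediate vertex contributes, with sign -1. *)
have term a b c : coef v [:: a; b; c] *
    (coef (epath R 2 [:: i; k]) [:: b; c] - coef (epath R 2 [:: i; k]) [:: a; c]
      + coef (epath R 2 [:: i; k]) [:: a; b]) =
    - (coef v [:: a; b; c] * ((a == i) && (c == k))%:R).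
  rewrite !coef_epath //.
  have [/andP[ab bc]|/v0->] := boolP (E a b && E b c); last first.
    by rewrite !mul0r oppr0.
  rewrite !eqseq_cons !andbT (eq_sym a) (eq_sym c).
  have -> : (i == b) && (k == c) = false.
    by apply: contraNF nik => /andP[/eqP-> /eqP->].
  have -> : (i == a) && (k == b) = false.
    by apply: contraNF nik => /andP[/eqP-> /eqP->].
  by rewrite sub0r addr0 mulrN.
rewrite -sumrN [RHS](bigD1 i) //=.
rewrite [X in _ = _ + X]big1 ?addr0 => [|a /negPf ai].
  rewrite -sumrN; apply: eq_bigr => b _.
  rewrite [X in - X](bigD1 k) //= term !eqxx mulr1.
  rewrite big1 ?addr0 ?opprK // => c /negPf ck.
  by rewrite term ck andbF mulr0 oppr0.
rewrite big1 ?oppr0 // => b _; rewrite big1 // => c _.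
by rewrite term ai mulr0 oppr0.
Qed.

End Levels.

Theorem theorem4p1 (R : realType) (V : finType) (E : rel V)
    (E_irr : irreflexive E)
    (no_multisq : no_multisquares E) (no_double : no_double_arrows E) :
  lambda_max (hodge_laplacian R E 1) <=
    (maxn (2 * \max_(i : V) deg E i)
          (\max_(xi : V * V | arrow E xi)
             (3 * deg_triangle E xi + 2 * deg_square E xi)))%:R.
Proof.
have bound l : passmx.leigenvalue (hodge_laplacian R E 1) l ->
    l <= (maxn (2 * \max_(i : V) deg E i)
          (\max_(xi : V * V | arrow E xi)
             (3 * deg_triangle E xi + 2 * deg_square E xi)))%:R.
  rewrite natr_max; apply: hodge_eigenvalue_le => [f g _|u v].
    exact: vertex_level_bound.
  exact: edge_level_bound.
(* The supremum over an empty spectrum is 0. *)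
rewrite /lambda_max; set S := (X in sup X).
have [->|S0] := eqVneq S set0; first by rewrite sup0.
by apply: ge_sup; [apply/set0P | move=> l /bound].
Qed.
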